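(* Suppose that $H$ satisfies conditions A, B and C. Let $\delta>0$ and $a\in C(\Omega)\cap L^\infty(\Omega)$, $\inf_\Omega a>0$. (a) Suppose that Case (i) holds ($\Omega$ being any bounded domain). Then $\lambda_\Omega<\infty$. (b) Suppose that Case (ii) holds, $\Omega$ satisfies a uniform outer ball condition, and $H$ satisfies condition D. Then $\lambda_\Omega<\infty$.
   Context: $\Omega\subset\mathbb{R}^n$, $n\ge2$, is a bounded domain; $S^n$ is the set of real symmetric $n\times n$ matrices, $O$ the zero matrix, $I$ the identity, $e$ always a unit vector in $\mathbb{R}^n$. Equations are understood in the viscosity sense. $H:\mathbb{R}^n\times S^n\to\mathbb{R}$ is continuous with $H(p,O)=0$ for all $p$. Condition A (monotonicity): $X\le Y$ implies $H(p,X)\le H(p,Y)$ for all $p$. Condition B (homogeneity): there are constants $k_1\ge0$ and $k_2>0$, an odd integer, with $H(\theta p,X)=|\theta|^{k_1}H(p,X)$ for all $\theta\in\mathbb{R}$ and $H(p,\theta X)=\theta^{k_2}H(p,X)$ for all $\theta>0$. Set $k=k_1+k_2$. Condition C (coercivity): for $s\in\mathbb{R}$ put $$m_1(s)=\min\Big\{\min_{|e|=1}H(e,I-se\otimes e),\,-\max_{|e|=1}H(e,se\otimes e-I)\Big\},$$ $$m_2(s)=\max\Big\{\max_{|e|=1}H(e,I-se\otimes e),\,-\min_{|e|=1}H(e,se\otimes e-I)\Big\}.$$ Then $m_1(k_1/k)>0$, and there are $-\infty<s_1\le1\le s_0<\infty$ and $0<\ell<\infty$ with $m_1(s)>0$ for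 all $s\le s_1$ and $m_2(s)<-\ell$ for all $s\ge s_0$. Condition D (symmetry): $H$ is invariant under rotations and reflections, i.e. $H(Qp,QXQ^T)=H(p,X)$ for every orthogonal matrix $Q$; so for radial $v(x)=v(r)$, $r=|x-z|$, $H(Dv,D^2v)$ is a function of $r,v'(r),v''(r)$ only. Case (i): there is $1<\bar s<2$ such that $m_2(\bar s)<0$. Case (ii): there is $\bar s\ge2$ such that $m_2(s)<0$ for all $s>\bar s$. Uniform outer ball condition: there is $\rho>0$ such that for every $y\in\partial\Omega$ there is $z\in\mathbb{R}^n$ with $B_\rho(z)\subset\mathbb{R}^n\setminus\Omega$ and $y\in\partial B_\rho(z)$. $\lambda_\Omega$ is the supremum of all $\lambda>0$ for which the problem $H(Du,D^2u)+\lambda a(x)|u|^{k-1}u=0$ in $\Omega$, $u=\delta$ on $\partial\Omega$, has a positive solution $u\in C(\overline\Omega)$. *)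

(* Defs.v *)
From mathcomp Require Import all_boot all_order all_algebra.
From mathcomp Require Import all_classical all_reals all_analysis.

Set Implicit Arguments.
Unset Strict Implicit.
Unset Printing Implicit Defensive.

Import Order.TTheory GRing.Theory Num.Theory.
Import numFieldNormedType.Exports.

Local Open Scope classical_set_scope.
Local Open Scope ring_scope.

Section Space.
Context {R : realType} {n : nat}.
Implicit Types (p x y z e : 'cV[R]_n) (X Y : 'M[R]_n) (Omega : set 'cV[R]_n).

(* The library norm on matrices is the sup norm; unit vectors and balls must be
   Euclidean (the two norms induce the same topology). *)
Definition enorm p : R := Num.sqrt (\sum_i p i 0 ^+ 2).

Definition eball z (r : R) : set 'cV[R]_n := [set x | enorm (x - z) < r].

Definition unit_sphere : set 'cV[R]_n := [set e | enorm e = 1].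

Definition tens e : 'M[R]_n := e *m e^T.

Definition symmx : set 'M[R]_n := [set X | X^T = X].

Definition loewner_le X Y : Prop :=
  forall v : 'cV[R]_n, (v^T *m X *m v) 0 0 <= (v^T *m Y *m v) 0 0.

Definition bdry Omega : set 'cV[R]_n := closure Omega `\` interior Omega.

Definition bounded_domain Omega : Prop :=
  [/\ open Omega, connected Omega, Omega !=set0 & bounded_set Omega].

Definition uniform_outer_ball Omega : Prop :=
  exists2 rho : R, 0 < rho &
    forall y, bdry Omega y ->
      exists z, eball z rho `<=` ~` Omega /\ bdry (eball z rho) y.

End Space.

(* A map on R^n x S^n is represented by a map H on all pairs (p, X) of which only
   the values at symmetric X are ever constrained or used. *)
Section Operator.
Context {R : realType} {n : nat}.
Variable H : 'cV[R]_n -> 'M[R]_n -> R.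

Definition operator : Prop :=
  {within [set pX : 'cV[R]_n * 'M[R]_n | symmx pX.2],
     continuous (fun pX => H pX.1 pX.2)} /\
  (forall p, H p 0 = 0).

Definition conditionA : Prop :=
  forall p X Y, symmx X -> symmx Y -> loewner_le X Y -> H p X <= H p Y.

(* [powR] satisfies 0 `^ 0 = 1. *)
Definition conditionB (k1 : R) (k2 : nat) : Prop :=
  [/\ 0 <= k1,
      (0 < k2)%N,
      odd k2,
      forall (theta : R) p X, symmx X ->
        H (theta *: p) X = `|theta| `^ k1 * H p X
    & forall (theta : R) p X, symmx X -> 0 < theta ->
        H p (theta *: X) = theta ^+ k2 * H p X].

(* For n >= 1 and H continuous, the infima and suprema over the (compact) unit
   sphere are attained. *)
Definition m1 (s : R) : R :=
  Num.min (inf [set H e (1%:M - s *: tens e) | e in unit_sphere])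
          (- sup [set H e (s *: tens e - 1%:M) | e in unit_sphere]).

Definition m2 (s : R) : R :=
  Num.max (sup [set H e (1%:M - s *: tens e) | e in unit_sphere])
          (- inf [set H e (s *: tens e - 1%:M) | e in unit_sphere]).

Definition conditionC (k1 k : R) : Prop :=
  0 < m1 (k1 / k) /\
  exists s1 s0 l : R,
    [/\ s1 <= 1, 1 <= s0, 0 < l,
        forall s, s <= s1 -> 0 < m1 s
      & forall s, s0 <= s -> m2 s < - l].

Definition conditionD : Prop :=
  forall (Q : 'M[R]_n) p X, Q *m Q^T = 1%:M -> symmx X ->
    H (Q *m p) (Q *m X *m Q^T) = H p X.

Definition caseI : Prop := exists s : R, [/\ 1 < s, s < 2 & m2 s < 0].

Definition caseII : Prop :=
  exists2 sbar : R, 2 <= sbar & forall s, sbar < s -> m2 s < 0.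

End Operator.

Section Viscosity.
Context {R : realType} {n : nat}.
Implicit Types (psi u : 'cV[R]_n -> R) (Omega : set 'cV[R]_n).

Definition evec (i : 'I_n) : 'cV[R]_n := delta_mx i 0.

Definition grad psi (x : 'cV[R]_n) : 'cV[R]_n := \col_i 'D_(evec i) psi x.

Definition hess psi (x : 'cV[R]_n) : 'M[R]_n :=
  \matrix_(i, j) 'D_(evec j) ('D_(evec i) psi) x.

(* [Omega] is meant to be open. The derivability clauses are needed because
   ['D_v f x] is a junk value when the limit does not exist. *)
Definition C2_on Omega psi : Prop :=
  forall x, Omega x ->
    [/\ {for x, continuous psi},
        forall i, derivable psi x (evec i),
        forall i, {for x, continuous ('D_(evec i) psi)},
        forall i j, derivable ('D_(evec i) psi) x (evec j)
      & forall i j, {for x, continuous ('D_(evec j) ('D_(evec i) psi))}].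

Definition local_max_at u (x : 'cV[R]_n) : Prop := \forall y \near x, u y <= u x.
Definition local_min_at u (x : 'cV[R]_n) : Prop := \forall y \near x, u x <= u y.

Variables (H : 'cV[R]_n -> 'M[R]_n -> R) (f : 'cV[R]_n -> R -> R).

(* Viscosity sub-, super- and solutions of H(Du, D^2 u) + f(x, u) = 0 in Omega;
   they are only used for u continuous. *)
Definition visc_subsolution Omega u : Prop :=
  forall psi x, C2_on Omega psi -> Omega x -> local_max_at (u \- psi) x ->
    0 <= H (grad psi x) (hess psi x) + f x (u x).

Definition visc_supersolution Omega u : Prop :=
  forall psi x, C2_on Omega psi -> Omega x -> local_min_at (u \- psi) x ->
    H (grad psi x) (hess psi x) + f x (u x) <= 0.

Definition visc_solution Omega u : Prop :=
  visc_subsolution Omega u /\ visc_supersolution Omega u.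

End Viscosity.

Section Eigenvalue.
Context {R : realType} {n : nat}.
Variables (H : 'cV[R]_n -> 'M[R]_n -> R) (k : R).
Variables (Omega : set 'cV[R]_n) (a : 'cV[R]_n -> R) (delta : R).

Definition positive_solution (lambda : R) (u : 'cV[R]_n -> R) : Prop :=
  [/\ {within closure Omega, continuous u},
      forall x, Omega x -> 0 < u x,
      forall x, bdry Omega x -> u x = delta
    & visc_solution H (fun x t => lambda * a x * (`|t| `^ (k - 1) * t)) Omega u].

Definition solvable : set R :=
  [set lambda | 0 < lambda /\ exists u, positive_solution lambda u].

Definition lambda_Omega : \bar R := ereal_sup [set lambda%:E | lambda in solvable].

End Eigenvalue.

(* Main.v *)
(* Fix a box |x_i - z_i| <= eps inside Omega and compare a positive
   supersolution u with the Gaussian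
     eta(x) = exp(-sg |x - z|^2) - exp(-sg eps^2),   sg = s0 / eps^2.
   The ratio eta / u attains its maximum M over the box at some x with
   |x - z| < eps, because eta <= 0 outside that ball, so eta / M touches u from
   below at x. The Hessian of eta at x is a positive multiple of
   s e (x) e - I with s = 2 sg |x - z|^2. If |x - z|^2 >= eps^2 / 2, then
   s >= s0 and condition C makes H(D eta, D^2 eta) > 0, which a supersolution
   forbids. Otherwise eta is bounded below at x, while by conditions A and B
   H(D eta, D^2 eta) is bounded below independently of u, which bounds lambda. *)

Require Import Defs.
From mathcomp Require Import all_boot all_order all_algebra.
From mathcomp Require Import all_classical all_reals all_analysis.
From mathcomp Require Import ring lra.

Import Order.TTheory GRing.Theory Num.Theory.
Import numFieldNormedType.Exports.

Local Open Scope classical_set_scope.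
Local Open Scope ring_scope.

(** * Derivatives and smoothness of the Gaussian bump *)

Section GaussianBump.
Context {R : realType} {n : nat}.
Implicit Types (x y z v : 'cV[R]_n) (s A B : R).

Definition sqnorm y : R := \sum_i y i 0 ^+ 2.

(** The parameters [A] and [B] let one family contain both the bump [eta] and its rescaling by
    [M^-1], so derivatives are computed once. *)
Definition gbump (s A B : R) z x : R := A * expR (- s * sqnorm (x - z)) - B.

(** Restriction to the line through [x] in direction [v] gives a one-variable function, to which the
    chain rule [is_derive1_comp] applies. *)
Lemma is_derive_line (f : 'cV[R]_n -> R) x v (d : R) :
  @is_derive R R R 0 1 (fun h : R => f (h *: v + x)) d <-> is_derive x v f d.
Proof.
suff E : 'D_v f x = 'D_1 (fun h : R => f (h *: v + x)) 0.
  split=> -[df dE].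
    by apply: (DeriveDef (iffRL (derivable1P f x v) df)); rewrite E.
  by apply: (DeriveDef (iffLR (derivable1P f x v) df)); rewrite -E.
rewrite /derive; set g1 := fun h => h^-1 *: _; set g2 := fun h => h^-1 *: _.
suff -> : g1 = g2 by [].
by apply/funext => h; rewrite /g1 /g2 /= addr0 scale0r add0r [_%:A]mulr1.
Qed.

Lemma is_derive_expR_comp (f : 'cV[R]_n -> R) x v (d : R) :
  is_derive x v f d -> is_derive x v (fun w => expR (f w)) (d * expR (f x)).
Proof.
move=> /is_derive_line df; apply/is_derive_line.
rewrite mulrC -[X in f X]add0r -[X in f (X + _)](scale0r v).
exact: (@is_derive1_comp _ expR (fun h => f (h *: v + x))).
Qed.

Lemma is_derive_coord z (i j : 'I_n) x :
  is_derive x (evec j) (fun w : 'cV[R]_n => w i 0 - z i 0) (i == j)%:R.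
Proof.
apply/is_derive_line.
rewrite (_ : (fun _ => _) = ((i == j)%:R \*: @id R) + cst (x i 0 - z i 0)).
  apply: is_derive_eq.
  by rewrite addr0 [_ *: _]mulr1.
by apply/funext => h; rewrite !fctE /= !mxE eqxx andbT /GRing.scale /=; ring.
Qed.

Lemma is_derive_sqnorm z (j : 'I_n) x :
  is_derive x (evec j) (fun w => sqnorm (w - z)) (2 * (x j 0 - z j 0)).
Proof.
rewrite (_ : (fun _ => _) =
  \sum_(i < n) ((fun w : 'cV[R]_n => w i 0 - z i 0) *
                (fun w : 'cV[R]_n => w i 0 - z i 0))); last first.
  apply/funext => w; rewrite /sqnorm fct_sumE; apply: eq_bigr => i _.
  by rewrite !mxE expr2.
apply: is_derive_eq.
  by apply: is_derive_sum => i; apply: is_deriveM; exact: is_derive_coord.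
rewrite (bigD1 j) //= eqxx big1 ?addr0 => [|i /negPf ij].
  by rewrite /GRing.scale /=; ring.
by rewrite ij !scaler0 addr0.
Qed.

Lemma is_derive_gauss s A z (j : 'I_n) x :
  is_derive x (evec j) (fun w => A * expR (- s * sqnorm (w - z)))
    (- (2 * s * (x j 0 - z j 0)) * (A * expR (- s * sqnorm (x - z)))).
Proof.
rewrite (_ : (fun _ => _) =
  A \*: (fun w => expR ((- s \*: (fun w => sqnorm (w - z))) w))) //.
apply: is_derive_eq.
  apply: is_deriveZ; apply: is_derive_expR_comp; apply: is_deriveZ.
  exact: is_derive_sqnorm.
by rewrite /GRing.scale /=; ring.
Qed.

Lemma is_derive_gbump s A B z (j : 'I_n) x :
  is_derive x (evec j) (gbump s A B z)
    (- (2 * s * (x j 0 - z j 0)) * (A * expR (- s * sqnorm (x - z)))).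
Proof.
rewrite (_ : gbump _ _ _ _ = (fun w => A * expR (- s * sqnorm (w - z))) - cst B) //.
apply: is_derive_eq; first by apply: is_deriveB; exact: is_derive_gauss.
by rewrite subr0.
Qed.

Lemma derive_gbump s A B z (i : 'I_n) :
  'D_(evec i) (gbump s A B z) =
  (fun x => - (2 * s * (x i 0 - z i 0)) * (A * expR (- s * sqnorm (x - z)))).
Proof. by apply/funext => x; case: (is_derive_gbump s A B z i x). Qed.

Lemma is_derive2_gbump s A B z (i j : 'I_n) x :
  is_derive x (evec j) ('D_(evec i) (gbump s A B z))
    (2 * s * (A * expR (- s * sqnorm (x - z))) *
     (2 * s * ((x i 0 - z i 0) * (x j 0 - z j 0)) - (i == j)%:R)).
Proof.
rewrite derive_gbump (_ : (fun _ => _) =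
  cst (- (2 * s)) * (fun w : 'cV[R]_n => w i 0 - z i 0) *
  (fun w => A * expR (- s * sqnorm (w - z)))); last first.
  by apply/funext => w; rewrite !fctE /=; ring.
apply: is_derive_eq.
  apply: is_deriveM; last exact: is_derive_gauss.
  by apply: is_deriveM; exact: is_derive_coord.
by rewrite !fctE /GRing.scale /=; ring.
Qed.

Lemma derive2_gbump s A B z (i j : 'I_n) :
  'D_(evec j) ('D_(evec i) (gbump s A B z)) =
  (fun x => 2 * s * (A * expR (- s * sqnorm (x - z))) *
     (2 * s * ((x i 0 - z i 0) * (x j 0 - z j 0)) - (i == j)%:R)).
Proof.
by apply/funext => x; case: (is_derive2_gbump s A B z i j x).
Qed.

Lemma continuous_coordB z (i : 'I_n) :
  continuous (fun x : 'cV[R]_n => x i 0 - z i 0).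
Proof.
move=> x; apply: (@cvgB _ _ _ (nbhs x) _ (fun x => x i 0) (cst (z i 0))).
  exact: (@coord_continuous R n 1 i 0 x).
exact: cvg_cst.
Qed.

Lemma continuous_sqnorm z : continuous (fun x => sqnorm (x - z)).
Proof.
rewrite (_ : (fun _ => _) =
  (fun x : 'cV[R]_n => \sum_(i < n) (x i 0 - z i 0) * (x i 0 - z i 0))); last first.
  by apply/funext => w; apply: eq_bigr => i _; rewrite !mxE.
apply: continuous_big => [|i _ x]; first exact: add_continuous.
by apply: (@cvgM _ _ (nbhs x)); exact: (continuous_coordB z _ x).
Qed.

Lemma continuous_gauss s A z :
  continuous (fun x => A * expR (- s * sqnorm (x - z))).
Proof.
move=> x; apply: (@cvgM _ _ (nbhs x)); first exact: cvg_cst.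
apply: (@continuous_comp _ _ _ (fun x => - s * sqnorm (x - z)) expR).
  by apply: (@cvgM _ _ (nbhs x)); [exact: cvg_cst|exact: (continuous_sqnorm z x)].
exact: continuous_expR.
Qed.

Lemma continuous_gbump s A B z : continuous (gbump s A B z).
Proof.
move=> x; apply: (@cvgB _ _ _ (nbhs x)); last exact: cvg_cst.
exact: (continuous_gauss s A z x).
Qed.

Lemma C2_on_gbump (Omega : set 'cV[R]_n) s A B z : C2_on Omega (gbump s A B z).
Proof.
move=> x _; split.
- exact: (continuous_gbump s A B z x).
- by move=> i; case: (is_derive_gbump s A B z i x).
- move=> i; rewrite derive_gbump.
  apply: (@cvgM _ _ (nbhs x)); last exact: (continuous_gauss s A z x).
  apply: (@cvgN _ _ _ (nbhs x)); apply: (@cvgM _ _ (nbhs x)); first exact: cvg_cst.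
  exact: (continuous_coordB z i x).
- by move=> i j; case: (is_derive2_gbump s A B z i j x).
- move=> i j; rewrite derive2_gbump; apply: (@cvgM _ _ (nbhs x)).
    apply: (@cvgM _ _ (nbhs x)); first exact: cvg_cst.
    exact: (continuous_gauss s A z x).
  apply: (@cvgB _ _ _ (nbhs x)); last exact: cvg_cst.
  apply: (@cvgM _ _ (nbhs x)); first exact: cvg_cst.
  apply: (@cvgM _ _ (nbhs x)); first exact: (continuous_coordB z i x).
  exact: (continuous_coordB z j x).
Qed.

Lemma grad_gbump s A B z x :
  grad (gbump s A B z) x =
  - (2 * s * (A * expR (- s * sqnorm (x - z)))) *: (x - z).
Proof.
apply/colP => i; rewrite /grad !mxE.
by case: (is_derive_gbump s A B z i x) => _ ->; ring.
Qed.

Lemma hess_gbump s A B z x :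
  hess (gbump s A B z) x =
  (2 * s * (A * expR (- s * sqnorm (x - z)))) *:
    ((2 * s) *: tens (x - z) - 1%:M).
Proof.
apply/matrixP => i j; rewrite /hess !mxE big_ord1 !mxE.
by case: (is_derive2_gbump s A B z i j x) => _ ->.
Qed.

End GaussianBump.

(** * Compact boxes and continuous functions on them *)

Section Compactness.
Context {R : realType} {n : nat}.
Implicit Types (x y z v : 'cV[R]_n).

Lemma continuous_trmx (m p : nat) : continuous (fun v : 'M[R]_(m, p) => v^T).
Proof.
move=> v P [Q Qv QP]; exists (fun i j => Q j i) => [i j|w Qw /=].
  by have := Qv j i; rewrite mxE.
by apply: QP => i j; rewrite mxE; exact: Qw.
Qed.

Definition box z (e : R) : set 'cV[R]_n :=
  [set x | forall i, `|x i 0 - z i 0| <= e].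

(** A product of segments is compact for row vectors ([rV_compact]); transposition carries this to
    columns. *)
Lemma compact_box z e : compact (box z e).
Proof.
have -> : box z e = (fun v : 'rV[R]_n => v^T) @`
    [set v : 'rV[R]_n | forall i, `[z i 0 - e, z i 0 + e]%classic (v ord0 i)].
  apply/seteqP; split=> [x xe|_ [v ve <-] i].
    exists x^T; rewrite ?trmxK // => i.
    by rewrite /= in_itv /= mxE -ler_distl; exact: xe.
  by have := ve i; rewrite /= in_itv /= mxE -ler_distl.
apply: continuous_compact; last first.
  apply: (@rV_compact R n (fun i => `[z i 0 - e, z i 0 + e]%classic)) => i.
  exact: segment_compact.
exact/continuous_subspaceT/continuous_trmx.
Qed.

Lemma nbhs_box x z (e : R) : (forall i, `|x i 0 - z i 0| < e) -> nbhs x (box z e).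
Proof.
move=> xe.
have /filter_forall : forall i,
    \forall y \near nbhs x, `|(y : 'cV[R]_n) i 0 - z i 0| <= e.
  move=> i.
  have ci : `|(y : 'cV[R]_n) i 0 - z i 0| @[y --> x] --> `|x i 0 - z i 0|.
    apply: (cvg_norm (F := nbhs x) (f := fun x => x i 0 - z i 0)).
    exact: (continuous_coordB z i x).
  near=> y; apply: ltW; near: y.
  exact: (cvgr_lt _ ci _ (xe i)).
exact.
Unshelve. all: by end_near. Qed.

Lemma open_box (Omega : set 'cV[R]_n) z : open Omega -> Omega z ->
  exists2 e : R, 0 < e & box z e `<=` Omega.
Proof.
move=> oO Oz; have /nbhs_ballP[r /= r0 rO] : nbhs z Omega by exact: open_nbhs_nbhs.
(* Halving [r] puts the closed box inside the open ball. *)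
exists (r / 2); first by rewrite divr_gt0.
move=> x xe; apply: rO; split=> // i j; rewrite ord1 /ball /= distrC.
by apply: le_lt_trans (xe i) _; rewrite ltr_pdivrMr // ltr_pMr // ltr1n.
Qed.

Lemma continuous_box_lower_bound (f : 'cV[R]_n -> R) z e : 0 <= e ->
  continuous f -> exists C : R, forall x, box z e x -> C <= f x.
Proof.
move=> e0 cf.
have b0 : box z e !=set0 by exists z => i; rewrite subrr normr0.
have [c _ fc] := compact_EVT_min b0 (compact_box z e) (continuous_subspaceT cf).
by exists (f c) => x xz; apply: fc; rewrite inE.
Qed.

End Compactness.

(** * Sign and scaling properties of the operator *)

Section OperatorBounds.
Context {R : realType} {n : nat}.
Variable H : 'cV[R]_n -> 'M[R]_n -> R.
Implicit Types (p x y z v e : 'cV[R]_n) (X : 'M[R]_n).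

(* The strict inequality excludes the junk value 0 of the infimum of a set that
   is empty or unbounded below. *)
Lemma lbound_of_inf_gt0 (A : set R) (x : R) : 0 < inf A -> A x -> inf A <= x.
Proof.
move=> A0 Ax; apply: (ge_inf _ Ax).
apply: contrapT => nA; move: A0; rewrite inf_out ?ltxx //.
by case.
Qed.

(** A negative maximum makes its entry [- inf] negative, so the infimum is positive and hence a true
    lower bound. *)
Lemma m2_lower_bound (s : R) e : m2 H s < 0 -> enorm e = 1 ->
  0 < H e (s *: tens e - 1%:M).
Proof.
rewrite /m2 gt_max => /andP[_]; rewrite oppr_lt0 => m0 e1.
by apply: (lt_le_trans m0); apply: lbound_of_inf_gt0 => //; exists e.
Qed.

Lemma tensZ (r : R) y : tens (r *: y) = r ^+ 2 *: tens y.
Proof. by rewrite /tens linearZ /= -scalemxAl -scalemxAr scalerA -expr2. Qed.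

Lemma symmx_tensB1 (s : R) y : symmx (s *: tens y - 1%:M).
Proof. by rewrite /symmx /= linearB linearZ /= trmx1 /tens trmx_mul trmxK. Qed.

Lemma symmxN1 : symmx (- 1%:M : 'M[R]_n).
Proof. by rewrite /symmx /= linearN /= trmx1. Qed.

(** The two quadratic forms differ at [v] by [s] times the squared inner product of [y] and [v]. *)
Lemma loewner_leN1_tens (s : R) y : 0 <= s -> loewner_le (- 1%:M) (s *: tens y - 1%:M).
Proof.
move=> s0 v; rewrite addrC mulmxDr mulmxDl [leRHS]mxE lerDl.
rewrite -scalemxAr -scalemxAl [leRHS]mxE mulr_ge0 // /tens.
have -> : v^T *m (y *m y^T) *m v = (y^T *m v)^T *m (y^T *m v).
  by rewrite trmx_mul trmxK !mulmxA.
by rewrite mxE big_ord1 [_^T _ _]mxE -expr2 sqr_ge0.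
Qed.

(** The slice of all pairs [(p, X)] stays among the symmetric pairs, so continuity within that set
    becomes unrestricted continuity in [p]. *)
Lemma continuous_operator X : operator H -> symmx X -> continuous (H^~ X).
Proof.
move=> [/subspace_continuousP cH _] sX p.
have {}cH := cH (p, X) sX.
apply: (cvg_comp (fun q => (q, X)) (fun qX => H qX.1 qX.2) _ cH).
move=> P /= [[U V] /= [nU nV] UV].
apply: filterS nU => q Uq; apply: UV => //; split=> //=.
exact: nbhs_singleton nV.
Qed.

Section Homogeneity.
Variables (k1 : R) (k2 : nat) (hB : conditionB H k1 k2).

(** The gradient of a bump carries a factor [- tau] and its Hessian [tau]; condition B sees only the
    absolute value of the former. *)
Lemma homogeneous t p X : symmx X -> t != 0 ->
  H (t *: p) (`|t| *: X) = `|t| `^ (k1 + k2%:R) * H p X.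
Proof.
case: hB => k10 _ _ Hp HX sX t0; rewrite Hp; last first.
  by rewrite /symmx /= linearZ /= sX.
rewrite HX ?normr_gt0 // mulrA powRD ?normr_eq0 ?t0 ?implybT //.
by rewrite powR_mulrn.
Qed.

(** Write [y] as [enorm y] times a unit vector [e]. Then [t *: tens y] is [s *: tens e] with
    [s = t * sqnorm y], and the positive factor from condition B keeps the sign given by [m2]. *)
Lemma quadratic_tens_gt0 (s0 t : R) y :
  (forall s, s0 <= s -> m2 H s < 0) -> 0 < s0 -> s0 <= t * sqnorm y ->
  0 < H y (t *: tens y - 1%:M).
Proof.
move=> m2s s00 sy.
have y0 : 0 < sqnorm y.
  rewrite lt_def sumr_ge0 ?andbT => [|i _]; last exact: sqr_ge0.
  by apply: contraTneq sy => ->; rewrite mulr0 -ltNge.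
have r0 : 0 < enorm y by rewrite sqrtr_gt0.
have r2 : enorm y ^+ 2 = sqnorm y by rewrite sqr_sqrtr // ltW.
pose e := (enorm y)^-1 *: y.
have ye : y = enorm y *: e by rewrite scalerA divff ?scale1r // gt_eqF.
have e1 : enorm e = 1.
  rewrite /enorm (_ : \sum_i _ = 1) ?sqrtr1 //.
  under eq_bigr do rewrite mxE exprMn.
  by rewrite -mulr_sumr -/(sqnorm y) -r2 -exprMn mulVf ?expr1n // gt_eqF.
have te : t *: tens y = (t * sqnorm y) *: tens e.
  by rewrite [in LHS]ye tensZ scalerA r2.
have [_ _ _ Hp _] := hB.
rewrite te {1}ye Hp ?mulr_gt0 ?powR_gt0 ?normr_gt0 ?gt_eqF //.
  by apply: m2_lower_bound => //; exact: m2s.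
exact: symmx_tensB1.
Qed.
End Homogeneity.
End OperatorBounds.

(** * Bounding [lambda] by comparison with the bump *)

Section EigenvalueBound.
Context {R : realType} {n : nat}.
Variables (H : 'cV[R]_n -> 'M[R]_n -> R) (k1 : R) (k2 : nat).
Hypotheses (hH : operator H) (hA : conditionA H) (hB : conditionB H k1 k2).

(** [L] is fixed before [lambda] and [u], so it also bounds the supremum defining [lambda_Omega]. *)
Lemma supersolution_bound (Omega : set 'cV[R]_n) z (eps s0 alpha : R)
    (a : 'cV[R]_n -> R) :
  0 < eps -> box z eps `<=` Omega ->
  0 < s0 -> (forall s, s0 <= s -> m2 H s < 0) ->
  0 < alpha -> (forall x, Omega x -> alpha <= a x) ->
  exists L : R, forall (lambda : R) (u : 'cV[R]_n -> R), 0 < lambda ->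
    {within box z eps, continuous u} -> (forall x, Omega x -> 0 < u x) ->
    visc_supersolution H
      (fun x t => lambda * a x * (`|t| `^ (k1 + k2%:R - 1) * t)) Omega u ->
    lambda <= L.
Proof.
move=> eps0 boxO s00 m2s alpha0 ha.
have [k10 k20 _ _ _] := hB; set k := k1 + k2%:R.
have k0 : 0 < k by rewrite ltr_wpDl // ltr0n.
(* The box is centred at [0] because [H] will be evaluated at [x - z]. *)
have [C CH] : exists C : R, forall y, box 0 eps y -> C <= H y (- 1%:M).
  apply: (@continuous_box_lower_bound R n (H^~ (- 1%:M))); first exact: ltW.
  exact: (continuous_operator _ _ hH symmxN1).
pose sg := s0 / eps ^+ 2.
have sg0 : 0 < sg by rewrite divr_gt0 // exprn_gt0.
(* [b] makes the bump vanish at distance [eps] from [z]; [c] is its value at squared distance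
   [eps ^+ 2 / 2]. *)
pose b := expR (- sg * eps ^+ 2).
pose c := expR (- sg * (eps ^+ 2 / 2)) - b.
have c0 : 0 < c.
  by rewrite subr_gt0 ltr_expR; have := mulr_gt0 sg0 (exprn_gt0 2 eps0); lra.
(* Near the centre, [lambda * alpha] times the [k]-th power of [c / M] will be at most [|C|] times
   the [k]-th power of [2 * sg / M]; the factor [M], which depends on [u], cancels. *)
exists ((2 * sg / c) `^ k * `|C| / alpha) => lambda u lambda0 cu u0 supu.
pose eta := gbump sg 1 b z.
have uK x : box z eps x -> 0 < u x by move=> /boxO; exact: u0.
have zz : box z eps z by move=> i; rewrite subrr normr0 ltW.
have [x xK xmax] : exists2 x, box z eps x &
    forall y, box z eps y -> eta y / u y <= eta x / u x.
  have [||x xK xmax] := @compact_EVT_max _ R (fun x => eta x / u x) (box z eps) _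
    (compact_box z eps).
  - by exists z.
  - apply/subspace_continuousP => x Kx; apply: cvgM.
      by apply: cvg_within_filter; exact: (continuous_gbump sg 1 b z x).
    apply: cvgV; first by rewrite gt_eqF ?uK.
    exact: (iffLR (subspace_continuousP _ _) cu).
  - by exists x => [|y Ky]; [rewrite inE in xK|apply: xmax; rewrite inE].
set M := eta x / u x in xmax.
have ux0 := uK x xK.
have etaz : 0 < eta z.
  rewrite /eta /gbump /sqnorm subrr big1 => [|i _]; last by rewrite mxE expr0n.
  rewrite mulr0 expR0 mul1r subr_gt0 /b expR_lt1.
  by rewrite mulNr oppr_lt0 mulr_gt0 ?exprn_gt0.
have M0 : 0 < M by apply: lt_le_trans (xmax z zz); rewrite divr_gt0 ?uK.
have etax : eta x = M * u x by rewrite divfK ?gt_eqF.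
pose q := sqnorm (x - z).
have q0 : 0 <= q by apply: sumr_ge0 => i _; exact: sqr_ge0.
(* Positivity of the bump at [x] puts [x] in the open Euclidean ball, hence in the interior of the
   box, so touching on the box is touching on a neighbourhood. *)
have qeps : q < eps ^+ 2.
  have : 0 < eta x by rewrite etax mulr_gt0.
  by rewrite /eta /gbump mul1r subr_gt0 ltr_expR ltr_nM2l // oppr_lt0.
have xint i : `|x i 0 - z i 0| < eps.
  suff : `|x i 0 - z i 0| ^+ 2 < eps ^+ 2 by rewrite ltr_pXn2r ?nnegrE // ltW.
  rewrite real_normK ?num_real //.
  apply: le_lt_trans qeps; rewrite /q /sqnorm (bigD1 i) //= !mxE lerDl.
  by apply: sumr_ge0 => j _; exact: sqr_ge0.
(* This is [eta / M], which equals [u] at [x] and lies below [u] on the box. *)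
pose psi := gbump sg M^-1 (M^-1 * b) z.
have psiE y : psi y = M^-1 * eta y by rewrite /psi /eta /gbump; ring.
have xloc : local_min_at (u \- psi) x.
  apply: filterS (nbhs_box _ _ _ xint) => y Ky /=.
  rewrite !psiE etax mulKf ?gt_eqF // subrr subr_ge0 mulrC.
  by rewrite ler_pdivrMr // mulrC -ler_pdivrMr ?uK // xmax.
have := supu psi x (@C2_on_gbump _ _ Omega sg M^-1 (M^-1 * b) z) (boxO _ xK) xloc.
rewrite grad_gbump hess_gbump -/q.
set tau := 2 * sg * _; set X := (2 * sg) *: _ - _.
have tau0 : 0 < tau by rewrite mulr_gt0 // mulr_gt0 // ?invr_gt0 ?expR_gt0.
have sX : symmx X by exact: symmx_tensB1.
have -> : H (- tau *: (x - z)) (tau *: X) = tau `^ k * H (x - z) X.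
  have := homogeneous _ _ _ hB (- tau) (x - z) _ sX.
  by rewrite normrN gtr0_norm // => -> //; rewrite oppr_eq0 gt_eqF.
rewrite (gtr0_norm ux0) [_ `^ _ * u x]mulrC mulr_powRB1 ?(ltW ux0) // => supux.
have ax := ha x (boxO _ xK).
have ax0 := lt_le_trans alpha0 ax.
(* By the choice of [sg], [qlarge] says exactly that [2 * sg * q >= s0]; both terms of [supux] are
   then positive, a contradiction. *)
have [qlarge|qsmall] := leP (eps ^+ 2 / 2) q.
  have HX : 0 < H (x - z) X.
    apply: (quadratic_tens_gt0 _ _ _ hB s0) => //; rewrite -/q.
    apply: (@le_trans _ _ (2 * sg * (eps ^+ 2 / 2))).
      by rewrite /sg [leRHS](_ : _ = s0) //; field; rewrite gt_eqF.
    by rewrite ler_pM2l // mulr_gt0.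
  move: supux; rewrite leNgt addr_gt0 //.
    by rewrite mulr_gt0 // powR_gt0.
  by rewrite !mulr_gt0 // powR_gt0.
(* Dropping the nonnegative tensor part of [X] leaves the bound [C]. Its sign is unknown, and [|C|]
   allows the upper bound on [tau] to be used later. *)
have HX : - `|C| <= H (x - z) X.
  apply: (@le_trans _ _ (H (x - z) (- 1%:M))).
    have : - `|C| <= C by rewrite lerNl -normrN ler_norm.
    move=> /le_trans; apply; apply: CH => i.
    by rewrite !mxE subr0; exact: xK.
  apply: hA => //; first exact: symmxN1.
  by apply: loewner_leN1_tens; rewrite mulr_ge0 // ltW.
have uc : c / M <= u x.
  rewrite ler_pdivrMr // mulrC -etax /eta /gbump mul1r lerB // ler_expR.
  by rewrite ler_nM2l ?oppr_lt0 // ltW.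
have sgc0 : 0 < 2 * sg / c by rewrite divr_gt0 // mulr_gt0.
have cM0 : 0 < c / M by rewrite divr_gt0.
(* The factor [c / M] is split off to cancel against the lower bound [uc] for [u x]. *)
have tauM : tau <= 2 * sg / c * (c / M).
  have -> : 2 * sg / c * (c / M) = 2 * sg * (M^-1 * 1).
    by field; rewrite !gt_eqF.
  rewrite /tau ler_pM2l; last by rewrite mulr_gt0.
  rewrite ler_pM2l ?invr_gt0 // -[leRHS]expR0 ler_expR.
  by rewrite mulNr oppr_le0 mulr_ge0 // ltW.
have powmono : {in Num.nneg &, {homo (@powR R)^~ k : s t / s <= t}}.
  by apply: ge0_ler_powR; exact: ltW.
have tauk : tau `^ k <= (2 * sg / c) `^ k * (c / M) `^ k.
  rewrite -powRM ?(ltW sgc0) ?(ltW cM0) //.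
  by apply: powmono; rewrite ?nnegrE // ltW // mulr_gt0.
have uk : (c / M) `^ k <= u x `^ k.
  by apply: powmono; rewrite ?nnegrE // ltW.
have P0 : 0 < (c / M) `^ k by rewrite powR_gt0.
rewrite ler_pdivlMr // -(ler_pM2r P0).
apply: (@le_trans _ _ (lambda * a x * u x `^ k)).
  apply: ler_pM uk; [by rewrite mulr_ge0 // ltW|exact: ltW|by rewrite ler_pM2l].
apply: (@le_trans _ _ (tau `^ k * `|C|)).
  have : tau `^ k * (- `|C|) <= tau `^ k * H (x - z) X.
    by rewrite ler_wpM2l // powR_ge0.
  by move: supux; lra.
by rewrite mulrAC ler_wpM2r.
Qed.

End EigenvalueBound.

(** * Finiteness of [lambda_Omega] *)

Theorem theorem1p6 (R : realType) (n : nat) (hn : (2 <= n)%N)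
    (Omega : set 'cV[R]_n) (hOmega : bounded_domain Omega)
    (H : 'cV[R]_n -> 'M[R]_n -> R) (hH : operator H)
    (hA : conditionA H)
    (k1 : R) (k2 : nat) (hB : conditionB H k1 k2)
    (k : R) (hk : k = k1 + k2%:R)
    (hC : conditionC H k1 k)
    (delta : R) (hdelta : 0 < delta)
    (a : 'cV[R]_n -> R) (ha_cont : {within Omega, continuous a})
    (ha_bdd : [bounded a x | x in Omega])
    (ha_inf : 0 < inf [set a x | x in Omega]) :
  (caseI H -> (lambda_Omega H k Omega a delta < +oo)%E) /\
  (caseII H -> uniform_outer_ball Omega -> conditionD H ->
     (lambda_Omega H k Omega a delta < +oo)%E).
Proof.
(* One bound serves both parts: condition C makes [m2] negative from [s0] on, which is the sign that
   the comparison uses. *)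
suff : (lambda_Omega H k Omega a delta < +oo)%E by [].
have [oO _ [z Oz] _] := hOmega.
have [_ [s1 [s0 [l [_ s01 l0 _ m2s]]]]] := hC.
have [eps eps0 boxO] := open_box Omega z oO Oz.
have s00 : 0 < s0 by rewrite (lt_le_trans _ s01).
have m2s0 s : s0 <= s -> m2 H s < 0.
  by move=> /m2s /lt_trans; apply; rewrite oppr_lt0.
have ha x : Omega x -> inf [set a x | x in Omega] <= a x.
  by move=> Ox; apply: lbound_of_inf_gt0 => //; exists x.
have [L HL] := supersolution_bound _ _ _ hH hA hB _ _ _ _ _ _
  eps0 boxO s00 m2s0 ha_inf ha.
apply: (@le_lt_trans _ _ L%:E); last exact: ltry.
apply: ge_ereal_sup => _ [lambda [lambda0 [u [cu u0 _ [_ supu]]]] <-].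
rewrite lee_fin; apply: (HL _ _ lambda0 _ u0); last by rewrite -hk.
apply: continuous_subspaceW cu; apply: subset_trans boxO _.
exact: subset_closure.
Qed.
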